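(* Let $P$ be the prefix monoid associated to the $E$-unitary special inverse monoid $S=\mathrm{Inv}\langle X\mid w_i=1\ (i\in I)\rangle$, and let $G$ be the maximal group image of $S$. Then the following are equivalent: (1) $S\Gamma$ is sprawling; (2) $G$ is the group of right quotients of $P$; (3) $P$ is right reversible, and every generator in $X$ occurs (in positive and/or negative form) in the relations. In particular, if any of the conditions (1), (2), (3) hold then $S$ is $F$-inverse.
   Context: An inverse monoid is a monoid $S$ in which every $s$ has a unique $s^{-1}$ with $ss^{-1}s=s$ and $s^{-1}ss^{-1}=s^{-1}$. $\mathrm{Inv}\langle X\mid R\rangle$ is the quotient of the free inverse monoid on $X$ by the congruence generated by $R$; it is special if all relations have the form $w_i=1$ with $w_i\in(X\cup X^{-1})^*$. The natural partial order is $s\le t$ iff $s=te$ for some idempotent $e$. Elements $s,t$ are $\mathcal{R}$-related iff $ss^{-1}=tt^{-1}$. The maximal group image is $G=S/\sigma$, where $\sigma$ is the least congruence identifying all idempotents; $\sigma\colon S\to G$ also denotes the natural homomorphism. $S$ is $E$-unitary if $\sigma$ is injective on each $\mathcal{R}$-class, and $F$-inverse if every $\sigma$-class has a maximum element in the natural partial order. The Schützenberger graph of $1$ has as vertices the $\mathcal{R}$-class of $1$ and edges $s\xrightarrow{x}sx$ ($x\in X\cup X^{-1}$) between such vertices. When $S$ is $E$-unitary, $\sigma$ embeds it in the Cayley graph $\Gamma(G)$ of $G$ with respect to $X$; $S\Gamma$ denotes the embedded copy. $S\Gamma$ is sprawling if $S\Gamma\cap gS\Gamma\neq\emptyset$ for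 every $g\in G$ (where $gS\Gamma$ is the left translate). The vertex set of $S\Gamma$ is a submonoid $P$ of $G$, called the prefix monoid; it is the submonoid of $G$ generated by the elements represented by all prefixes of the relators $w_i$. A cancellative monoid $P$ is right reversible if every two principal right ideals intersect, i.e. $pP\cap qP\ne\emptyset$ for all $p,q\in P$. A group $G$ containing $P$ as a submonoid is the group of right quotients of $P$ if every element of $G$ can be written as $pq^{-1}$ with $p,q\in P$. *)

(* Defs.v *)
From HB Require Import structures.
From mathcomp Require Import all_boot.
From mathcomp Require Import boolp classical_sets.

Set Implicit Arguments.
Unset Strict Implicit.
Unset Printing Implicit Defensive.

Local Open Scope quotient_scope.
Local Open Scope classical_set_scope.
Local Open Scope group_scope.

(** * Inverse monoids *)

Definition idempotent_elt (M : monoidType) (e : M) : Prop := e * e = e.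

Fact inverse_unique_subproof (M : monoidType) (a x y : M) :
  a * x * a = a -> x * a * x = x -> a * y * a = a -> y * a * y = y ->
  x * a * (y * a) = y * a * (x * a) -> a * x * (a * y) = a * y * (a * x) ->
  x = y.
Proof.
move=> axa xax aya yay xy xy'; transitivity (y * a * x).
  by rewrite -[in LHS]xax -{1}aya !mulgA -(mulgA (x * a)) xy -mulgA xax.
rewrite -[in RHS]yay -{2}axa -!mulgA; congr (y * _).
by rewrite (mulgA a x) xy' !mulgA aya.
Qed.

Section InverseFromUniqueness.
Variables (S : monoidType) (i : S -> S).
Hypothesis mulsVs : forall s : S, s * i s * s = s.
Hypothesis mulVsV : forall s : S, i s * s * i s = i s.
Hypothesis invs_uniq :
  forall s t : S, s * t * s = s -> t * s * t = t -> t = i s.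

Fact idem_inv_subproof (e : S) : e * e = e -> i e = e.
Proof. by move=> ee; apply/esym/invs_uniq; rewrite !ee. Qed.

Fact idem_mul_subproof (e f : S) :
  e * e = e -> f * f = f -> (e * f) * (e * f) = e * f.
Proof.
move=> ee ff; pose x := i (e * f).
have xefx : x * e * f * x = x by rewrite -(mulgA x) mulVsV.
have efxef : e * f * x * e * f = e * f by rewrite -(mulgA _ e) mulsVs.
have fx : f * x * e = x.
  apply: invs_uniq; rewrite !mulgA.
    by rewrite -(mulgA e f f) ff -(mulgA _ e e) ee.
  rewrite -(mulgA _ e e) ee -(mulgA _ f f) ff.
  by rewrite -!mulgA; congr (f * _); rewrite !mulgA xefx.
have xx : x * x = x.
  have : f * x * e * (f * x * e) = f * x * e.
    by rewrite -!mulgA; congr (f * _); rewrite !mulgA xefx.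
  by rewrite fx.
suff -> : e * f = x by [].
rewrite -(idem_inv_subproof xx); apply: invs_uniq; first exact: mulVsV.
exact: mulsVs.
Qed.

Fact idem_comm_subproof (e f : S) : e * e = e -> f * f = f -> e * f = f * e.
Proof.
move=> ee ff.
have efef := idem_mul_subproof ee ff; have fefe := idem_mul_subproof ff ee.
rewrite -(idem_inv_subproof efef); apply/esym/invs_uniq; rewrite !mulgA.
  by rewrite -(mulgA e f f) ff -(mulgA _ e e) ee -(mulgA (e * f)).
by rewrite -(mulgA f e e) ee -(mulgA _ f f) ff -(mulgA (f * e)).
Qed.

Fact invK_subproof : involutive i.
Proof. by move=> s; apply/esym/invs_uniq; [exact: mulVsV|exact: mulsVs]. Qed.

Fact invM_subproof : {morph i : x y / x * y >-> y * x}.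
Proof.
move=> s t.
have C : t * i t * (i s * s) = i s * s * (t * i t).
  by apply: idem_comm_subproof; rewrite mulgA (mulsVs, mulVsV).
apply/esym/invs_uniq.
  transitivity (s * (t * i t * (i s * s)) * t); first by rewrite !mulgA.
  by rewrite C !mulgA mulsVs -!mulgA (mulgA t) mulsVs.
transitivity (i t * (i s * s * (t * i t)) * i s); first by rewrite !mulgA.
by rewrite -C !mulgA mulVsV -!mulgA (mulgA (i s)) mulVsV.
Qed.

End InverseFromUniqueness.

(* An inverse monoid is a monoid in which every s has a unique inverse s^-1
   in the sense of the three fields below. MathComp requires structures to be
   declared above [starMonoidType]; the factory [Monoid_isInverseMonoid] shows
   that the two *-monoid laws follow from these fields. *)
HB.mixin Record isInverseMonoid S of StarMonoid S := {
  mulsVs : forall s : S, s * s^-1 * s = s;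
  mulVsV : forall s : S, s^-1 * s * s^-1 = s^-1;
  invs_uniq : forall s t : S, s * t * s = s -> t * s * t = t -> t = s^-1
}.

#[short(type="inverseMonoidType")]
HB.structure Definition InverseMonoid :=
  {S of isInverseMonoid S & StarMonoid S}.

HB.factory Record Monoid_isInverseMonoid S of Monoid S & BaseGroup S := {
  mulsVs : forall s : S, s * s^-1 * s = s;
  mulVsV : forall s : S, s^-1 * s * s^-1 = s^-1;
  invs_uniq : forall s t : S, s * t * s = s -> t * s * t = t -> t = s^-1
}.

HB.builders Context S of Monoid_isInverseMonoid S.
HB.instance Definition _ := Monoid_isStarMonoid.Build S
  (invK_subproof mulsVs mulVsV invs_uniq)
  (invM_subproof mulsVs mulVsV invs_uniq).
HB.instance Definition _ := isInverseMonoid.Build S mulsVs mulVsV invs_uniq.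
HB.end.

Section InverseMonoidTheory.
Variable S : inverseMonoidType.
Implicit Types s t e f : S.

Lemma idem_comm e f : idempotent_elt e -> idempotent_elt f -> e * f = f * e.
Proof. exact: (idem_comm_subproof mulsVs mulVsV invs_uniq). Qed.

Lemma idem_mulsV s : idempotent_elt (s * s^-1).
Proof. by rewrite /idempotent_elt mulgA mulsVs. Qed.

Lemma idem_mulVs s : idempotent_elt (s^-1 * s).
Proof. by rewrite /idempotent_elt mulgA mulVsV. Qed.

(* The natural partial order, Green's relation R, and the R-class of 1. *)
Definition nle s t : Prop := exists2 e, idempotent_elt e & s = t * e.

Definition greenR s t : Prop := s * s^-1 = t * t^-1.

Lemma greenR1P s : greenR s 1 <-> s * s^-1 = 1.
Proof. by rewrite /greenR mul1g invg1. Qed.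

Lemma greenR1M s t : greenR s 1 -> greenR t 1 -> greenR (s * t) 1.
Proof.
move=> /greenR1P s1 /greenR1P t1; apply/greenR1P.
by rewrite invgM mulgA -(mulgA s) t1 mulg1.
Qed.

End InverseMonoidTheory.

(* A regular *-monoid with commuting projections is an inverse monoid. *)
Lemma star_inverse_uniq (M : starMonoidType) :
  (forall x : M, x * x^-1 * x = x) ->
  (forall x y : M, x * x^-1 * (y * y^-1) = y * y^-1 * (x * x^-1)) ->
  forall x y : M, x * y * x = x -> y * x * y = y -> y = x^-1.
Proof.
move=> r c.
have r' (x : M) : x^-1 * x * x^-1 = x^-1 by rewrite -[x in _ * x * _]invgK r.
have idemi (e : M) : e * e = e -> e^-1 = e.
  move=> ee; have iee : e^-1 * e^-1 = e^-1 by rewrite -invgM ee.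
  have c' := c e e^-1; rewrite invgK in c'.
  transitivity (e^-1 * e * (e * e^-1)).
    by rewrite mulgA -(mulgA _ e e) ee r'.
  by rewrite -c' mulgA -(mulgA _ _ e^-1) iee r.
have comm (e f : M) : e * e = e -> f * f = f -> e * f = f * e.
  move=> ee ff.
  have -> : e = e * e^-1 by rewrite idemi.
  by have -> : f = f * f^-1 by rewrite idemi.
move=> x y xyx yxy.
have c1 : y * x * (x^-1 * x) = x^-1 * x * (y * x).
  by apply: comm; rewrite mulgA (r', yxy).
have c2 : x * x^-1 * (x * y) = x * y * (x * x^-1).
  by apply: comm; rewrite mulgA (r, xyx).
transitivity (x^-1 * x * y).
  transitivity (y * x * (x^-1 * x) * y).
    by rewrite mulgA -(mulgA y) -(mulgA y) r yxy.
  by rewrite c1 -mulgA yxy.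
transitivity (x^-1 * (x * x^-1 * (x * y))).
  by rewrite !mulgA r'.
by rewrite c2 !mulgA -(mulgA _ x y) -(mulgA x^-1 (x * y) x) xyx r'.
Qed.

(** * Quotients of monoids by generated congruences *)

(* The least congruence on [M] containing [R]. *)
Inductive cong_gen (M : monoidType) (R : M -> M -> Prop) : M -> M -> Prop :=
| Cong_gen a b : R a b -> cong_gen R a b
| Cong_refl a : cong_gen R a a
| Cong_sym a b : cong_gen R a b -> cong_gen R b a
| Cong_trans b a c : cong_gen R a b -> cong_gen R b c -> cong_gen R a c
| Cong_mul a b c d :
    cong_gen R a b -> cong_gen R c d -> cong_gen R (a * c) (b * d).

Section MonoidQuotient.
Variables (M : monoidType) (R : M -> M -> Prop).

Definition cong_genb : rel M := fun a b => `[< cong_gen R a b >].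

Lemma cong_genb_refl : reflexive cong_genb.
Proof. by move=> a; apply/asboolP; exact: Cong_refl. Qed.

Lemma cong_genb_sym : symmetric cong_genb.
Proof. by move=> a b; apply/asboolP/asboolP; exact: Cong_sym. Qed.

Lemma cong_genb_trans : transitive cong_genb.
Proof.
by move=> b a c /asboolP ab /asboolP bc; apply/asboolP; exact: Cong_trans bc.
Qed.

Canonical cong_gen_equiv :=
  EquivRel cong_genb cong_genb_refl cong_genb_sym cong_genb_trans.

Definition mquot : Type := {eq_quot cong_gen_equiv}.
HB.instance Definition _ := Choice.on mquot.
HB.instance Definition _ := EqQuotient.on mquot.

Definition mpi (a : M) : mquot := \pi_mquot a.

Lemma mpi_eqP a b : mpi a = mpi b <-> cong_gen R a b.
Proof.
split=> [/eqP|ab]; first by rewrite eqmodE => /asboolP.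
by apply/eqP; rewrite eqmodE; apply/asboolP.
Qed.

Lemma mpi_surj (q : mquot) : exists a, q = mpi a.
Proof. by exists (repr q); rewrite /mpi reprK. Qed.

Definition mquot_mul : mquot -> mquot -> mquot := lift_op2 mquot *%g.

Lemma repr_mpi a : cong_gen R (repr (mpi a)) a.
Proof. by apply/mpi_eqP; rewrite /mpi reprK. Qed.

Fact mquot_mulE a b : mquot_mul (mpi a) (mpi b) = mpi (a * b).
Proof.
by rewrite /mquot_mul; unlock; apply/mpi_eqP/Cong_mul; exact: repr_mpi.
Qed.

Fact mquot_mulA : associative mquot_mul.
Proof.
move=> p q r; have [a ->] := mpi_surj p; have [b ->] := mpi_surj q.
by have [c ->] := mpi_surj r; rewrite !mquot_mulE mulgA.
Qed.

Fact mquot_mul1g : left_id (mpi 1) mquot_mul.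
Proof. by move=> p; have [a ->] := mpi_surj p; rewrite mquot_mulE mul1g. Qed.

Fact mquot_mulg1 : right_id (mpi 1) mquot_mul.
Proof. by move=> p; have [a ->] := mpi_surj p; rewrite mquot_mulE mulg1. Qed.

HB.instance Definition _ :=
  isMonoid.Build mquot mquot_mulA mquot_mul1g mquot_mulg1.

Lemma mpiM a b : mpi (a * b) = mpi a * mpi b.
Proof. by rewrite -mquot_mulE. Qed.

Lemma mpi1 : mpi 1 = 1. Proof. by []. Qed.

End MonoidQuotient.

Section InverseMonoidQuotient.
Variables (S : inverseMonoidType) (R : S -> S -> Prop).
Local Notation pi := (mpi R).

Definition mquot_inv : mquot R -> mquot R := lift_op1 (mquot R) (@inv S).

Fact mquot_invE a : mquot_inv (pi a) = pi a^-1.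
Proof.
rewrite /mquot_inv; unlock; rewrite -[LHS]/(pi _); set b := repr _.
have ba : pi b = pi a by apply/mpi_eqP; exact: repr_mpi.
have xa : pi b^-1 * pi a = pi (b^-1 * b) by rewrite -ba mpiM.
have ax : pi a * pi b^-1 = pi (b * b^-1) by rewrite -ba mpiM.
apply: (@inverse_unique_subproof _ (pi a)); rewrite ?xa ?ax -!mpiM.
- by rewrite mpiM -ba -mpiM mulsVs.
- by rewrite mulVsV.
- by rewrite mulsVs.
- by rewrite mulVsV.
- by rewrite (idem_comm (idem_mulVs b) (idem_mulVs a)).
- by rewrite (idem_comm (idem_mulsV b) (idem_mulsV a)).
Qed.

HB.instance Definition _ := hasInv.Build (mquot R) mquot_inv.

Lemma mpiV a : pi a^-1 = (pi a)^-1.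
Proof. by rewrite -mquot_invE. Qed.

Fact mquot_invK : involutive (@inv (mquot R)).
Proof. by move=> p; have [a ->] := mpi_surj p; rewrite -!mpiV invgK. Qed.

Fact mquot_invM : {morph @inv (mquot R) : p q / p * q >-> q * p}.
Proof.
move=> p q; have [a ->] := mpi_surj p; have [b ->] := mpi_surj q.
by rewrite -mpiM -!mpiV -mpiM invgM.
Qed.

HB.instance Definition _ :=
  Monoid_isStarMonoid.Build (mquot R) mquot_invK mquot_invM.

Fact mquot_mulsVs (p : mquot R) : p * p^-1 * p = p.
Proof. by have [a ->] := mpi_surj p; rewrite -mpiV -!mpiM mulsVs. Qed.

Fact mquot_mulVsV (p : mquot R) : p^-1 * p * p^-1 = p^-1.
Proof. by have [a ->] := mpi_surj p; rewrite -mpiV -!mpiM mulVsV. Qed.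

Fact mquot_projC (p q : mquot R) :
  p * p^-1 * (q * q^-1) = q * q^-1 * (p * p^-1).
Proof.
have [a ->] := mpi_surj p; have [b ->] := mpi_surj q.
by rewrite -!mpiV -!mpiM (idem_comm (idem_mulsV a) (idem_mulsV b)).
Qed.

HB.instance Definition _ := isInverseMonoid.Build (mquot R)
  mquot_mulsVs mquot_mulVsV (star_inverse_uniq mquot_mulsVs mquot_projC).

End InverseMonoidQuotient.

(** * The free inverse monoid *)

(* Words over X and X^-1: (x, true) stands for x and (x, false) for x^-1. *)
Definition word (X : choiceType) : Type := seq (X * bool).

Section Words.
Variable X : choiceType.

HB.instance Definition _ := Choice.on (word X).

Definition winv (u : word X) : word X := rev [seq (l.1, ~~ l.2) | l <- u].

Fact winvK : involutive winv.
Proof.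
move=> u; rewrite /winv map_rev revK -map_comp -[RHS]map_id.
by apply: eq_map => -[x b] /=; rewrite negbK.
Qed.

Fact winvM : {morph winv : u v / u ++ v >-> v ++ u}.
Proof. by move=> u v; rewrite /winv map_cat rev_cat. Qed.

HB.instance Definition _ :=
  isStarMonoid.Build (word X) (@catA _) (@cat0s _) winvK winvM.

(* The defining relations of the free inverse monoid on X (Vagner). *)
Inductive vagner : word X -> word X -> Prop :=
| Vagner_regular u : vagner (u * u^-1 * u) u
| Vagner_commute u v :
    vagner (u * u^-1 * (v * v^-1)) (v * v^-1 * (u * u^-1)).

Definition freeInverseMonoid : Type := mquot vagner.
Local Notation FIM := freeInverseMonoid.

HB.instance Definition _ := EqQuotient.on FIM.
HB.instance Definition _ := Monoid.on FIM.

Definition fim_of_word (u : word X) : FIM := mpi vagner u.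

Fact vagner_inv u v : cong_gen vagner u v -> cong_gen vagner u^-1 v^-1.
Proof.
elim=> {u v} [_ _ [u|u v]|u|u v _|v u w _ uv _ vw|a b c d _ ab _ cd].
- by rewrite !invgM mulgA; apply: Cong_gen; exact: Vagner_regular.
- by rewrite !invgM !invgK; apply: Cong_gen; exact: Vagner_commute.
- exact: Cong_refl.
- exact: Cong_sym.
- exact: Cong_trans vw.
- by rewrite !invgM; exact: Cong_mul.
Qed.

Definition fim_inv : FIM -> FIM := lift_op1 FIM (@inv (word X)).

Fact fim_invE u : fim_inv (fim_of_word u) = fim_of_word u^-1.
Proof.
by rewrite /fim_inv; unlock; apply/mpi_eqP/vagner_inv; exact: repr_mpi.
Qed.

HB.instance Definition _ := hasInv.Build FIM fim_inv.

Lemma fim_of_wordV u : fim_of_word u^-1 = (fim_of_word u)^-1.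
Proof. by rewrite -fim_invE. Qed.

Lemma fim_of_wordM u v : fim_of_word (u * v) = fim_of_word u * fim_of_word v.
Proof. exact: mpiM. Qed.

Fact fim_invK : involutive (@inv FIM).
Proof.
by move=> p; have [u ->] := mpi_surj p; rewrite -!fim_of_wordV invgK.
Qed.

Fact fim_invM : {morph @inv FIM : p q / p * q >-> q * p}.
Proof.
move=> p q; have [u ->] := mpi_surj p; have [v ->] := mpi_surj q.
by rewrite -fim_of_wordM -!fim_of_wordV -fim_of_wordM invgM.
Qed.

HB.instance Definition _ := Monoid_isStarMonoid.Build FIM fim_invK fim_invM.

Fact fim_mulsVs (p : FIM) : p * p^-1 * p = p.
Proof.
have [u ->] := mpi_surj p; rewrite -fim_of_wordV -!fim_of_wordM.
by apply/mpi_eqP/Cong_gen; exact: Vagner_regular.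
Qed.

Fact fim_mulVsV (p : FIM) : p^-1 * p * p^-1 = p^-1.
Proof. by have := fim_mulsVs p^-1; rewrite invgK. Qed.

Fact fim_projC (p q : FIM) : p * p^-1 * (q * q^-1) = q * q^-1 * (p * p^-1).
Proof.
have [u ->] := mpi_surj p; have [v ->] := mpi_surj q.
rewrite -!fim_of_wordV -!fim_of_wordM.
by apply/mpi_eqP/Cong_gen; exact: Vagner_commute.
Qed.

HB.instance Definition _ := isInverseMonoid.Build FIM
  fim_mulsVs fim_mulVsV (star_inverse_uniq fim_mulsVs fim_projC).

End Words.

(** * Presentations and the maximal group image *)

Definition Inv (X : choiceType) (R : word X -> word X -> Prop) :
    inverseMonoidType :=
  @mquot (freeInverseMonoid X)
    (fun p q => exists u v, [/\ R u v, p = fim_of_word u & q = fim_of_word v]).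

Definition inv_word (X : choiceType) (R : word X -> word X -> Prop)
  (u : word X) : Inv R := mpi _ (fim_of_word u).

(* The relations w i = 1 (i in I), giving Inv<X | w i = 1 (i in I)>. *)
Definition special_rel (X : choiceType) (I : Type) (w : I -> word X)
  (u v : word X) : Prop := exists2 i, u = w i & v = 1.

Definition SpecialInv (X : choiceType) (I : Type) (w : I -> word X) :=
  Inv (special_rel w).

Section MaximalGroupImage.
Variable S : inverseMonoidType.

Definition idem_rel (e f : S) : Prop := idempotent_elt e /\ idempotent_elt f.

Definition maxGroupImage : Type := mquot idem_rel.

HB.instance Definition _ := StarMonoid.on maxGroupImage.

(* The natural homomorphism onto the maximal group image. *)
Definition sigma (s : S) : maxGroupImage := mpi idem_rel s.

Fact maxGroupImage_mulVg :
  left_inverse 1 (@inv maxGroupImage) (@mul maxGroupImage).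
Proof.
move=> p; have [s ->] := mpi_surj p.
rewrite -[_^-1]mpiV -[_ * _]mpiM; apply/mpi_eqP/Cong_gen; split.
  exact: idem_mulVs.
by rewrite /idempotent_elt mulg1.
Qed.

HB.instance Definition _ :=
  StarMonoid_isGroup.Build maxGroupImage maxGroupImage_mulVg.

Lemma sigmaM s t : sigma (s * t) = sigma s * sigma t.
Proof. exact: mpiM. Qed.

Definition E_unitary : Prop :=
  forall s t : S, greenR s t -> sigma s = sigma t -> s = t.

Definition F_inverse : Prop :=
  forall s : S, exists2 m : S, sigma m = sigma s &
    forall t, sigma t = sigma s -> nle t m.

End MaximalGroupImage.

(** * Schuetzenberger graphs *)

(* Graphs on subsets of V with edges labelled in L. *)
Record lgraph (V L : Type) := LGraph {
  vertices : set V;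
  edges : set (V * L * V)
}.

Definition graph_image (V W L : Type) (f : V -> W) (A : lgraph V L) :
    lgraph W L :=
  LGraph (f @` vertices A)
    [set e | exists s l t, edges A (s, l, t) /\ e = (f s, l, f t)].

Definition graph_meet (V L : Type) (A B : lgraph V L) : lgraph V L :=
  LGraph (vertices A `&` vertices B) (edges A `&` edges B).

Definition left_translate (G : groupType) (L : Type) (g : G) (A : lgraph G L) :=
  graph_image (fun h => g * h) A.

Section Special.
Variables (X : choiceType) (I : Type) (w : I -> word X).
Local Notation S := (SpecialInv w).
Local Notation G := (maxGroupImage S).

(* The Schuetzenberger graph of 1: its vertices are the elements R-related
   to 1, its edges are s --x--> s * x between such vertices. *)
Definition schutz1 : lgraph S (X * bool) :=
  LGraph [set s | greenR s 1]
    [set e | [/\ greenR e.1.1 1, greenR e.2 1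
              & e.2 = e.1.1 * inv_word (special_rel w) [:: e.1.2]]].

(* Its image under sigma in the Cayley graph of the maximal group image;
   sigma is injective on the vertices when S is E-unitary. *)
Definition SGamma : lgraph G (X * bool) := graph_image (@sigma S) schutz1.

(* A graph is nonempty when it has a vertex. *)
Definition sprawling : Prop :=
  forall g : G, vertices (graph_meet SGamma (left_translate g SGamma)) !=set0.

Definition prefix_monoid : {pred G} := fun g => `[< vertices SGamma g >].

Fact prefix_monoid1 : 1 \in prefix_monoid.
Proof. by apply/asboolP; exists 1. Qed.

Fact prefix_monoidM : mulg_closed prefix_monoid.
Proof.
move=> _ _ /asboolP[s s1 <-] /asboolP[t t1 <-]; apply/asboolP.
by exists (s * t); [exact: greenR1M|rewrite sigmaM].
Qed.

HB.instance Definition _ := isMulClosed.Build G prefix_monoid prefix_monoidM.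
HB.instance Definition _ := isMul1Closed.Build G prefix_monoid prefix_monoid1.

Definition all_generators_occur : Prop :=
  forall x : X, exists i : I, ((x, true) \in w i) || ((x, false) \in w i).

End Special.
Arguments prefix_monoid {X I} w _.

(** * Submonoids of a group *)

Section Quotients.
Variables (G : groupType) (P : umagmaClosed G).

Definition principal_right_ideal (p : G) : set G :=
  [set p * x | x in [set x | x \in P]].

Definition right_reversible : Prop :=
  {in P &, forall p q,
    principal_right_ideal p `&` principal_right_ideal q !=set0}.

Definition group_of_right_quotients : Prop :=
  forall g : G, exists p q, [/\ p \in P, q \in P & g = p * q^-1].

End Quotients.
Arguments group_of_right_quotients G P : clear implicits.

(* Main.v *)
From mathcomp Require Import all_boot.
From mathcomp Require Import boolp.
Require Import Defs.

(** Membership of [g] in [P P^-1] is the same as [S Gamma] meeting its translate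
    by [g].  If [P] is right reversible then [P P^-1] is a subgroup; it contains
    every letter [x] occurring in a relator [u x v], because [u] and [u x] lie
    in [P].  Conversely, if [x] occurs in no relator, then "[x] occurs in the
    word" is an invariant of elements of [S] and fails on the R-class of 1,
    while the parity of the number of occurrences of [x] is a homomorphism
    from [G] to Z/2; the latter is trivial on [P P^-1] but not at [x].
    Finally, if [sigma s = sigma a * (sigma b)^-1] with [a] and [b] in the
    R-class of 1, then [a * b^-1] is the maximum of the sigma-class of [s]. *)

Set Implicit Arguments.
Unset Strict Implicit.
Unset Printing Implicit Defensive.

Local Open Scope group_scope.

(** The target needs only a binary operation, so this also covers invariants with values in [bool]
    under [||] or [(+)]. *)
Lemma mquot_lift (M : monoidType) (R : M -> M -> Prop) (N : Type)
    (op : N -> N -> N) (f : M -> N) :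
  {morph f : a b / a * b >-> op a b} -> (forall a b, R a b -> f a = f b) ->
  exists2 g : mquot R -> N,
    {morph g : p q / p * q >-> op p q} & forall a, g (mpi R a) = f a.
Proof.
move=> fM fR.
have fC a b : cong_gen R a b -> f a = f b.
  elim=> {a b} [|//|a b _ ->//|b a c _ -> _ ->//|a b c d _ ab _ cd].
    exact: fR.
  by rewrite !fM ab cd.
exists (fun p => f (repr p)) => [p q|a]; last exact/fC/repr_mpi.
by rewrite -fM; apply/fC/mpi_eqP; rewrite mpiM /mpi !reprK.
Qed.

Section InverseMonoids.
Variable S : inverseMonoidType.
Implicit Types s t a b c : S.

Lemma greenR1_mull s t : s * t = 1 -> greenR s 1.
Proof. by move=> st; apply/greenR1P; rewrite -[LHS]mulg1 -[in LHS]st mulgA mulsVs. Qed.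

Lemma sigma1 : sigma (1 : S) = 1.
Proof. exact: mpi1. Qed.

Lemma sigmaV s : sigma s^-1 = (sigma s)^-1.
Proof. exact: mpiV. Qed.

Lemma sigma_idem s : idempotent_elt s -> sigma s = 1.
Proof.
by move=> ss; apply/mpi_eqP/Cong_gen; split=> //; rewrite /idempotent_elt mulg1.
Qed.

(** Since [a * a^-1 = 1], the element [c * c^-1 * a] is R-related to [c]; it has the same image, so
    it equals [c]. Conjugating by [a] then moves the idempotent to the right. *)
Lemma E_unitary_nle_greenR1 a c :
  E_unitary S -> greenR a 1 -> sigma c = sigma a -> nle c a.
Proof.
move=> uS /greenR1P a1 ca; pose f := c * c^-1.
have fi : f^-1 = f by rewrite /f invgM invgK.
have ff : f * f = f by exact: idem_mulsV.
have -> : c = f * a.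
  apply/esym/uS; last by rewrite sigmaM (sigma_idem (idem_mulsV c)) mul1g.
  by rewrite /greenR invgM fi mulgA -(mulgA f) a1 mulg1 ff.
move: f fi ff => f _ ff; exists (a^-1 * f * a); last by rewrite !mulgA a1 mul1g.
by rewrite /idempotent_elt !mulgA -(mulgA (a^-1 * f) a) a1 mulg1 -(mulgA a^-1 f f) ff.
Qed.

(** The previous lemma gives [t * b = a * e]. As [b * b^-1 = 1], this yields [t = a * e * b^-1], and
    [e] is conjugated past [b^-1]. *)
Lemma E_unitary_nle_mulV a b t :
  E_unitary S -> greenR a 1 -> greenR b 1 ->
  sigma t = sigma a * (sigma b)^-1 -> nle t (a * b^-1).
Proof.
move=> uS a1 b1 ts.
have [|e ee tb] := @E_unitary_nle_greenR1 a (t * b) uS a1.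
  by rewrite sigmaM ts mulgVK.
move/greenR1P: b1 => b1.
have eb : b^-1 * (b * e * b^-1) = e * b^-1.
  by rewrite !mulgA (idem_comm (idem_mulVs b) ee) -!mulgA (mulgA b^-1) mulVsV.
exists (b * e * b^-1); last first.
  by rewrite -mulgA eb mulgA -tb -mulgA b1 mulg1.
by rewrite /idempotent_elt -[LHS]mulgA eb mulgA -(mulgA b e e) ee.
Qed.

End InverseMonoids.

Section SpecialInverseMonoids.
Variables (X : choiceType) (I : Type) (w : I -> word X).
Local Notation S := (SpecialInv w).
Local Notation G := (maxGroupImage S).
Local Notation iw := (inv_word (special_rel w)).
Implicit Types (u v : word X) (p q g : G).

Lemma inv_wordM u v : iw (u * v) = iw u * iw v.
Proof. by rewrite /inv_word fim_of_wordM mpiM. Qed.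

Lemma inv_word_surj (s : S) : exists u, s = iw u.
Proof. by have [p ->] := mpi_surj s; have [u ->] := mpi_surj p; exists u. Qed.

Lemma inv_word_relator i : iw (w i) = 1.
Proof. by apply/mpi_eqP/Cong_gen; exists (w i), 1; split=> //; exists i. Qed.

Lemma special_inv_lift (N : Type) (op : N -> N -> N) (f : word X -> N) :
  {morph f : u v / u * v >-> op u v} ->
  (forall u v, vagner u v -> f u = f v) -> (forall i, f (w i) = f 1) ->
  exists2 h : S -> N,
    {morph h : s t / s * t >-> op s t} & forall u, h (iw u) = f u.
Proof.
move=> fM fV fw; have [h hM hf] := mquot_lift fM fV.
have hR (a b : freeInverseMonoid X) :
    (exists u v, [/\ special_rel w u v, a = fim_of_word u & b = fim_of_word v]) ->
    h a = h b.
  by move=> [_ [_ [[i -> ->] -> ->]]]; rewrite !hf fw.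
have [h' h'M h'h] := mquot_lift hM hR.
by exists h' => // u; rewrite h'h hf.
Qed.

Lemma prefix_monoidP p :
  reflect (exists2 s : S, greenR s 1 & sigma s = p) (p \in prefix_monoid w).
Proof. exact: asboolP. Qed.

(** A prefix of a relator is right invertible in [S], hence R-related to 1. *)
Lemma prefix_in_prefix_monoid i u v :
  w i = u ++ v -> sigma (iw u) \in prefix_monoid w.
Proof.
move=> wE; apply/prefix_monoidP; exists (iw u) => //.
by apply: (@greenR1_mull _ _ (iw v)); rewrite -inv_wordM -[u * v]wE inv_word_relator.
Qed.

Lemma sprawlingP :
  sprawling w <-> group_of_right_quotients G (prefix_monoid w).
Proof.
split=> [spr g|quo g].
  have [p [Pp [q Pq gq]]] := spr g.
  by exists p, q; split; [exact/asboolP|exact/asboolP|rewrite -gq mulgK].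
have [p [q [/asboolP Pp /asboolP Pq ->]]] := quo g.
by exists p; split=> //; exists q => //; rewrite mulgVK.
Qed.

(** A factorisation [p^-1 * q = a * b^-1] rearranges to the common multiple [p * a = q * b]. *)
Lemma quotients_right_reversible :
  group_of_right_quotients G (prefix_monoid w) ->
  right_reversible (prefix_monoid w).
Proof.
move=> quo p q _ _; have [a [b [Pa Pb e]]] := quo (p^-1 * q).
exists (p * a); split; [by exists a|exists b => //].
by rewrite -[q](mulVKg p) e -!mulgA mulVg mulg1.
Qed.

Lemma winv_count x u :
  count (fun l : X * bool => l.1 == x) u^-1 = count (fun l => l.1 == x) u.
Proof. by rewrite [u^-1]/(winv u) /winv count_rev count_map. Qed.

Lemma quotients_all_generators_occur :
  group_of_right_quotients G (prefix_monoid w) -> all_generators_occur w.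
Proof.
move=> quo x; apply: contrapT => xw; pose isx (l : X * bool) := l.1 == x.
have w0 i : count isx (w i) = 0.
  apply/eqP; rewrite -leqn0 leqNgt -has_count.
  apply/negP => /hasP[[y b] yw /eqP/= yx]; apply: xw; exists i.
  by case: b yw => yw; rewrite -yx yw ?orbT.
pose occ u := has isx u; pose par u := odd (count isx u).
have catE u v : u * v = u ++ v by [].
have occV u : occ u^-1 = occ u by rewrite /occ !has_count winv_count.
have parV u : par u^-1 = par u by rewrite /par winv_count.
have occM : {morph occ : u v / u * v >-> u || v}.
  by move=> u v; rewrite /occ catE has_cat.
have parM : {morph par : u v / u * v >-> u (+) v}.
  by move=> u v; rewrite /par catE count_cat oddD.
(* Occurrence of [x] descends to [S]: relators avoid [x], and both sides of a Vagner relation have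
   the same letters up to sign. *)
have [h hM hE] : exists2 h : S -> bool,
    {morph h : s t / s * t >-> s || t} & forall u, h (iw u) = occ u.
  apply: special_inv_lift => // [_ _ [u|u v]|i].
  - by rewrite !occM occV !orbb.
  - by rewrite !occM !occV orbC.
  - by rewrite /occ has_count w0.
have [k kM kE] : exists2 k : S -> bool,
    {morph k : s t / s * t >-> s (+) t} & forall u, k (iw u) = par u.
  apply: special_inv_lift => // [_ _ [u|u v]|i].
  - by rewrite !parM parV addbb.
  - by rewrite !parM !parV !addbb.
  - by rewrite /par w0.
(* The only idempotent of [(+)] is [false], so parity descends further to [G]. *)
have k_idem e : idempotent_elt e -> k e = false.
  by move=> ee; rewrite -ee kM addbb.
have k_idem_rel e f : @idem_rel S e f -> k e = k f.
  by move=> [/k_idem -> /k_idem ->].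
have [m mM mE] := mquot_lift kM k_idem_rel.
(* Occurrence in a product is a disjunction, so [s * s^-1 = 1] forces a word for [s] to avoid [x];
   its parity is then even. *)
have mP p : p \in prefix_monoid w -> m p = false.
  case/prefix_monoidP=> s /greenR1P s1 <-; rewrite [LHS]mE.
  have [u su] := inv_word_surj s; rewrite su kE /par.
  have : h s = false.
    have : h (s * s^-1) = false by rewrite s1 -[1]/(iw [::]) hE.
    by rewrite hM => /norP[/negbTE].
  by rewrite su hE /occ has_count lt0n => /eqP ->.
(* [m] is only known to respect products, so the inverse is cleared by multiplying by [q]. *)
have [p [q [/mP mp /mP mq xpq]]] := quo (sigma (iw [:: (x, true)])).
have : m (sigma (iw [:: (x, true)]) * q) = m p by rewrite xpq mulgVK.
by rewrite mM mq mp [m _]mE kE /par /= /isx eqxx.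
Qed.

Lemma right_reversible_quotients :
  right_reversible (prefix_monoid w) -> all_generators_occur w ->
  group_of_right_quotients G (prefix_monoid w).
Proof.
move=> rev occ.
pose Q g := exists p q,
  [/\ p \in prefix_monoid w, q \in prefix_monoid w & g = p * q^-1].
have QV g : Q g -> Q g^-1.
  by move=> [p [q [Pp Pq ->]]]; exists q, p; split=> //; rewrite invgM invgK.
(* Right reversibility turns left quotients into right ones: [p * a = q * b] gives
   [p^-1 * q = a * b^-1]. *)
have QVM p q : p \in prefix_monoid w -> q \in prefix_monoid w -> Q (p^-1 * q).
  move=> Pp Pq; have [_ [[a Pa <-] [b Pb qb]]] := rev p q Pp Pq.
  exists a, b; split=> //; apply: (mulgI p).
  by rewrite mulVKg mulgA -qb mulgK.
(* The inner factor [q^-1 * r] is rewritten as [a * b^-1], so the product becomes the quotient of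
   [p * a] by [s * b]. *)
have QM g g' : Q g -> Q g' -> Q (g * g').
  move=> [p [q [Pp Pq ->]]] [r [s [Pr Ps ->]]].
  have [a [b [Pa Pb e]]] := QVM q r Pq Pr.
  exists (p * a), (s * b); split; [exact: prefix_monoidM|exact: prefix_monoidM|].
  by rewrite invgM !mulgA -(mulgA p q^-1) e !mulgA.
have Ql_occ i l : l \in w i -> Q (sigma (iw [:: l])).
  move=> /path.splitPr wE; case wi: _ / wE => [u v].
  have Pu : sigma (iw u) \in prefix_monoid w.
    exact: prefix_in_prefix_monoid wi.
  have Pul : sigma (iw ((u : word X) * [:: l])) \in prefix_monoid w.
    by apply: (@prefix_in_prefix_monoid i _ v); rewrite -[_ * _]/(_ ++ _) -catA.
  by have := QVM _ _ Pu Pul; rewrite inv_wordM sigmaM mulKg.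
have letterV x b : sigma (iw [:: (x, ~~ b)]) = (sigma (iw [:: (x, b)]))^-1.
  rewrite -sigmaV; congr sigma; rewrite -mpiV -fim_of_wordV.
  by congr (mpi _ (fim_of_word _)).
(* If only the opposite sign of the letter occurs in a relator, closure of [Q] under inverses
   supplies it. *)
have Ql l : Q (sigma (iw [:: l])).
  case: l => x b; have [i] := occ x.
  have [xb|xb] := boolP ((x, b) \in w i); first by move=> _; exact: Ql_occ xb.
  move=> xw; rewrite -[b]negbK letterV; apply: QV; apply: (Ql_occ i).
  by case: b xb xw => /negbTE->; rewrite ?orbF.
move=> g; have [s ->] := mpi_surj g; have [u ->] := inv_word_surj s.
rewrite -/(Q _) -/(sigma _); elim: u => [|l u IH].
  rewrite [iw _]mpi1 sigma1; exists 1, 1; rewrite mulgV.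
  by split=> //; exact: prefix_monoid1.
by rewrite -[l :: u]/(([:: l] : word X) * u) inv_wordM sigmaM; apply: QM.
Qed.

Lemma quotients_F_inverse :
  E_unitary S -> group_of_right_quotients G (prefix_monoid w) -> F_inverse S.
Proof.
move=> uS quo s.
have [_ [_ [/prefix_monoidP[a a1 <-] /prefix_monoidP[b b1 <-] sE]]] :=
  quo (sigma s).
exists (a * b^-1) => [|t ts]; first by rewrite sigmaM sigmaV.
by apply: E_unitary_nle_mulV => //; rewrite ts.
Qed.

End SpecialInverseMonoids.

Theorem proposition4p11 (X : choiceType) (I : Type) (w : I -> word X) :
  E_unitary (SpecialInv w) ->
  [<-> sprawling w;
       group_of_right_quotients (maxGroupImage (SpecialInv w)) (prefix_monoid w);
       right_reversible (prefix_monoid w) /\ all_generators_occur w]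
  /\ (sprawling w \/
      group_of_right_quotients (maxGroupImage (SpecialInv w)) (prefix_monoid w) \/
      (right_reversible (prefix_monoid w) /\ all_generators_occur w) ->
      F_inverse (SpecialInv w)).
Proof.
move=> uS; split.
  tfae=> [/sprawlingP//|quo|[rev occ]].
    by split; [exact: quotients_right_reversible|
               exact: quotients_all_generators_occur].
  exact/sprawlingP/right_reversible_quotients.
move=> H; apply: quotients_F_inverse => //.
by case: H => [/sprawlingP//|[//|[rev occ]]]; exact: right_reversible_quotients.
Qed.
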